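(* Let $G$ be a connected simple graph with $n \geq 3$ vertices and let $\alpha\in[0,1]$. Then $$2\alpha - 1 \leq \lambda_2(A_\alpha(l(G))) \leq n(\alpha+1) - 4.$$ Equality occurs in the lower bound when $G \cong P_3$, and in the upper bound when $G \cong K_n$.
   Context: For a simple graph $H$ with adjacency matrix $A(H)$ and diagonal degree matrix $D(H)$, and $\alpha\in[0,1]$, $A_\alpha(H)=\alpha D(H)+(1-\alpha)A(H)$, with eigenvalues ordered $\lambda_1\ge\lambda_2\ge\dots$. The line graph $l(G)$ has the edges of $G$ as vertices, two being adjacent iff the corresponding edges share an endpoint. $P_3$ is the path on 3 vertices and $K_n$ the complete graph. *)

(* Defs.v *)
From HB Require Import structures.
From mathcomp Require Import all_boot all_order all_algebra.
From mathcomp Require Import polyrcf reals.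

Set Implicit Arguments.
Unset Strict Implicit.
Unset Printing Implicit Defensive.

Import Order.TTheory GRing.Theory Num.Theory.

Record sgraph := SGraph {
  vertex :> finType;
  adj : rel vertex;
  adj_sym : symmetric adj;
  adj_irr : irreflexive adj }.

Definition graph_connected (G : sgraph) : Prop :=
  forall x y : G, connect (@adj G) x y.

Definition graph_iso (G H : sgraph) : Prop :=
  exists2 f : G -> H, bijective f & forall x y, adj (f x) (f y) = adj x y.

Notation "G ~=g H" := (graph_iso G H) (at level 70, no associativity).

Section CompleteGraph.
Variable n : nat.
Definition complete_adj : rel 'I_n := fun i j => i != j.
Fact complete_adj_sym : symmetric complete_adj.
Proof. by move=> i j; rewrite /complete_adj eq_sym. Qed.
Fact complete_adj_irr : irreflexive complete_adj.
Proof. by move=> i; rewrite /complete_adj eqxx. Qed.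
Definition complete_graph := SGraph complete_adj_sym complete_adj_irr.
End CompleteGraph.

Section PathGraph.
Variable n : nat.
Definition path_adj : rel 'I_n :=
  fun i j => (i.+1 == j :> nat) || (j.+1 == i :> nat).
Fact path_adj_sym : symmetric path_adj.
Proof. by move=> i j; rewrite /path_adj orbC. Qed.
Fact path_adj_irr : irreflexive path_adj.
Proof. by move=> i; rewrite /path_adj orbb -[_.+1]addn1 -{2}[nat_of_ord i]addn0 eqn_add2l. Qed.
Definition path_graph := SGraph path_adj_sym path_adj_irr.
End PathGraph.

Section LineGraph.
Variable G : sgraph.

Definition edges : {set {set G}} :=
  [set E | [exists x, exists y, adj x y && (E == [set x; y])]].

Definition edge : finType := {E : {set G} | E \in edges}.

Definition line_adj : rel edge :=
  fun E F => (E != F) && (val E :&: val F != set0).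
Fact line_adj_sym : symmetric line_adj.
Proof. by move=> E F; rewrite /line_adj eq_sym setIC. Qed.
Fact line_adj_irr : irreflexive line_adj.
Proof. by move=> E; rewrite /line_adj eqxx. Qed.
Definition line_graph := SGraph line_adj_sym line_adj_irr.
End LineGraph.

Local Open Scope ring_scope.

Section GraphMatrices.
Variables (R : realType) (H : sgraph).

Definition degree (x : H) : nat := #|[set y | adj x y]|.

(* Rows and columns are numbered by the enumeration of the vertices. *)
Definition adjacency_mx : 'M[R]_#|H| :=
  \matrix_(i, j) (adj (enum_val i) (enum_val j))%:R.

Definition degree_mx : 'M[R]_#|H| :=
  diag_mx (\row_i (degree (enum_val i))%:R).

Definition Aalpha_mx (alpha : R) : 'M[R]_#|H| :=
  alpha *: degree_mx + (1 - alpha) *: adjacency_mx.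
End GraphMatrices.

Section Spectrum.
Variables (R : realType) (m : nat).
Implicit Type M : 'M[R]_m.

(* All real eigenvalues in nonincreasing order, each repeated according to its
   multiplicity as a root of the characteristic polynomial. *)
Definition eigenvalues M : seq R :=
  sort >=%R (flatten
    [seq nseq (mup x (char_poly M)) x | x <- rootsR (char_poly M)]).

(* The eigenvalues are numbered from 1; the default value 0 is only taken when
   there are fewer than k of them. *)
Definition lambda (k : nat) M : R := (eigenvalues M)`_k.-1.

Lemma eigenvaluesE M (s : seq R) :
  char_poly M = \prod_(x <- s) ('X - x%:P) -> eigenvalues M = sort >=%R s.
Proof.
move=> Ms; have p0 : char_poly M != 0 by rewrite monic_neq0 ?char_poly_monic.
have tot : total (>=%R : rel R) by move=> x y; exact: le_total.
have tr : transitive (>=%R : rel R) by move=> x y z; exact: ge_trans.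
have asym : antisymmetric (>=%R : rel R) by exact: ge_anti.
apply/(perm_sortP tot tr asym); apply/allP => x _ /=; apply/eqP.
have mupE : mup x (char_poly M) = count_mem x s.
  rewrite Ms; elim: {Ms} s => [|y s IHs]; first by rewrite big_nil mupNroot // root1.
  have s0 : \prod_(z <- s) ('X - z%:P) != 0 :> {poly R}.
    by rewrite monic_neq0 // monic_prod // => z _; exact: monicXsubC.
  rewrite big_cons mupM ?polyXsubC_eq0 // IHs -[X in mup x X]expr1 mup_XsubCX.
  by rewrite /=; case: eqP.
rewrite -mupE count_flatten -map_comp sumnE big_map.
have uR : uniq (rootsR (char_poly M)) by exact: uniq_roots.
rewrite (eq_bigr (fun y => if y == x then mup y (char_poly M) else 0%N)); last first.
  by move=> y _; rewrite /= count_nseq /=; case: eqP => _; rewrite ?mul1n ?mul0n.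
rewrite -big_mkcond /=.
have [xr|xr] := boolP (x \in rootsR (char_poly M)).
  by rewrite (big_rem x) //= eqxx big1_seq ?addn0 // => y /andP[/eqP-> ];
    rewrite mem_rem_uniq // inE eqxx.
rewrite big1_seq => [|y /andP[/eqP-> yr]]; last by rewrite yr in xr.
rewrite mupNroot //; apply: contra xr => rx.
by rewrite -roots_on_rootsR // rx.
Qed.
End Spectrum.

(* Main.v *)
(** For a real symmetric matrix A, lambda_2 is at most c as soon as the quadratic
form of A is at most c times the squared norm on a hyperplane, and at least c as
soon as the reverse inequality holds on a plane.

Writing z_v for the sum of x_e over the edges e containing v, the adjacency form
of the line graph is the sum of z_v^2 minus 2|x|^2.  If the entries of x add up
to 0, so do those of z; then the sum of (z_u + z_v)^2 over the edges is at most
the same sum over all pairs, which is (n - 2)|z|^2, and since the incidence map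
and its adjoint have the same norm, |z|^2 <= (n - 2)|x|^2.  As the degrees in the
line graph are at most 2n - 4, the upper bound follows.  For K_n all of this is
sharp on the vectors x_e = y_u + y_v with y of sum 0; for P_3 the degrees in the
line graph are 1, which improves the bound to 2 alpha - 1.  For the lower bound,
the plane is spanned by the indicators of two adjacent edges. *)

Require Import Defs.
From mathcomp Require Import all_boot all_order all_algebra.
From mathcomp Require Import spectral sesquilinear complex ring lra zify.
From mathcomp Require Import reals.

Set Implicit Arguments.
Unset Strict Implicit.
Unset Printing Implicit Defensive.

Import Order.TTheory GRing.Theory Num.Theory.

Local Open Scope ring_scope.

(** * The second eigenvalue of a real symmetric matrix *)

Section Variational.
Local Open Scope sesquilinear_scope.
Variable R : realType.
Local Notation toC := (real_complex R).
Local Notation mxRe := (map_mx (@complex.Re R)).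
Local Notation mxIm := (map_mx (@complex.Im R)).

Definition quad m (M : 'M[R]_m) (u : 'rV[R]_m) : R := (u *m M *m u^T) 0 0.

Lemma quadE m (M : 'M[R]_m) u :
  quad M u = \sum_i \sum_j u 0 i * M i j * u 0 j.
Proof.
rewrite /quad mxE exchange_big /=; apply: eq_bigr => j _.
by rewrite !mxE mulr_suml.
Qed.

Lemma quad_diag m (d u : 'rV[R]_m) :
  quad (diag_mx d) u = \sum_i d 0 i * u 0 i ^+ 2.
Proof.
rewrite quadE; apply: eq_bigr => i _; rewrite (bigD1 i) //= big1 => [|j ji].
  by rewrite addr0 !mxE eqxx mulr1n mulrAC expr2 mulrC.
by rewrite !mxE eq_sym (negPf ji) mulr0n mulr0 mul0r.
Qed.

Lemma quad1 m (u : 'rV[R]_m) : quad 1%:M u = \sum_i u 0 i ^+ 2.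
Proof.
rewrite -diag_const_mx quad_diag; apply: eq_bigr => i _.
by rewrite mxE mul1r.
Qed.

Lemma Re_sum (I : Type) (s : seq I) (P : pred I) (F : I -> R[i]) :
  complex.Re (\sum_(i <- s | P i) F i) = \sum_(i <- s | P i) complex.Re (F i).
Proof. by apply: big_morph => // -[a b] [c d]. Qed.

Lemma Im_sum (I : Type) (s : seq I) (P : pred I) (F : I -> R[i]) :
  complex.Im (\sum_(i <- s | P i) F i) = \sum_(i <- s | P i) complex.Im (F i).
Proof. by apply: big_morph => // -[a b] [c d]. Qed.

Lemma mxRe_mulmx_real m n p (x : 'M[R[i]]_(m, n)) (B : 'M[R]_(n, p)) :
  mxRe (x *m map_mx toC B) = mxRe x *m B.
Proof.
apply/matrixP => i j; rewrite !mxE Re_sum; apply: eq_bigr => k _.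
by rewrite !mxE; case: (x i k) => a b /=; rewrite mulr0 subr0.
Qed.

Lemma mxIm_mulmx_real m n p (x : 'M[R[i]]_(m, n)) (B : 'M[R]_(n, p)) :
  mxIm (x *m map_mx toC B) = mxIm x *m B.
Proof.
apply/matrixP => i j; rewrite !mxE Im_sum; apply: eq_bigr => k _.
by rewrite !mxE; case: (x i k) => a b /=; rewrite mulr0 add0r mulrC.
Qed.

(** For x = u + i v, the cross terms between u and v are purely imaginary and drop out of the real
    part. *)
Lemma Re_hermitian_form m (M : 'M[R]_m) (x : 'rV[R[i]]_m) :
  complex.Re ((x *m map_mx toC M *m x^t*) 0 0)
  = quad M (mxRe x) + quad M (mxIm x).
Proof.
rewrite /quad -mxRe_mulmx_real -mxIm_mulmx_real !mxE Re_sum -big_split /=.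
apply: eq_bigr => k _; rewrite !mxE; case: (x 0 k) => c d.
by case: (\sum_j _) => a b /=; rewrite mulrN opprK.
Qed.

Lemma char_poly_conj (F : fieldType) m (P D : 'M[F]_m) : P \in unitmx ->
  char_poly (invmx P *m D *m P) = char_poly D.
Proof.
move=> Pu; rewrite /char_poly.
have PpK : map_mx polyC (invmx P) *m map_mx polyC P = 1%:M.
  by rewrite -map_mxM mulVmx // map_mx1.
have -> : char_poly_mx (invmx P *m D *m P)
    = map_mx polyC (invmx P) *m char_poly_mx D *m map_mx polyC P.
  rewrite /char_poly_mx mulmxBr mulmxBl !map_mxM /=; congr (_ - _).
  by rewrite scalar_mxC -mulmxA PpK mulmx1.
by rewrite !det_mulmx mulrAC -det_mulmx PpK det1 mul1r.
Qed.

(** The spectral theorem is applied over [R[i]], where the complexified matrix is hermitian. Its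
    diagonal is then real and descends to [r]; the factored characteristic polynomial descends
    because [toC] is injective on polynomials. *)
Lemma symmetric_spectral m (A : 'M[R]_m) : A^T = A ->
  exists P : 'M[R[i]]_m, exists r : 'rV[R]_m,
  [/\ P \is unitarymx, map_mx toC A = P^t* *m map_mx toC (diag_mx r) *m P
    & char_poly A = \prod_i ('X - (r 0 i)%:P)].
Proof.
move=> symA; set B := map_mx toC A.
have Bherm : B \is hermsymmx.
  apply: realsym_hermsym.
    by apply/is_hermitianmxP; rewrite expr0 scale1r map_mx_id // map_trmx symA.
  by apply/mxOverP => i j; rewrite mxE; apply/complex_realP; exists (A i j).
have /orthomx_spectralP Bspec := hermitian_normalmx Bherm.
have /mxOverP dreal := hermitian_spectral_diag_real Bherm.
pose P := spectralmx B; pose r := mxRe (spectral_diag B).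
have PU : P \is unitarymx by exact: spectral_unitarymx.
have dE : map_mx toC r = spectral_diag B.
  by apply/matrixP => i j; rewrite !mxE RRe_real.
exists P, r; rewrite map_diag_mx dE -invmx_unitary //; split=> //.
apply: (map_poly_inj toC); rewrite map_char_poly -/B.
rewrite Bspec char_poly_conj ?unitarymx_unit // char_poly_trig ?diag_mx_is_trig //.
rewrite rmorph_prod /=; apply: eq_bigr => i _.
by rewrite rmorphB /= map_polyX map_polyC /= -dE !mxE eqxx mulr1n.
Qed.

(** Sorting the indices instead of the values keeps [i0] and [i1] distinct even when the two largest
    values coincide. *)
Lemma sorted_second m (r : 'I_m -> R) : (1 < m)%N ->
  exists i0, exists i1, [/\ i0 != i1, (sort >=%R (codom r))`_1 = r i1,
    r i1 <= r i0 & forall j, j != i0 -> r j <= r i1].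
Proof.
move=> m1; pose t := sort (relpre r >=%R) (enum 'I_m).
have tE : sort >=%R (codom r) = map r t by rewrite /codom /image_mem sort_map.
have szt : size t = m by rewrite size_sort size_enum_ord.
have ut : uniq t by rewrite sort_uniq enum_uniq.
have trans : transitive (relpre r >=%R).
  by move=> x y z /= h1 h2; exact: le_trans h2 h1.
have st : sorted (relpre r >=%R) t by apply: sort_sorted => x y /=; exact: le_total.
have memt j : j \in t by rewrite mem_sort mem_enum.
rewrite tE; case: t szt ut st memt {tE} => [|i0 [|i1 t]] //=.
- by move=> m0; rewrite -m0 in m1.
- by move=> m0; rewrite -m0 in m1.
move=> _ /andP[+ _] /andP[r01 st] memt; rewrite inE negb_or => /andP[i01 _].
exists i0, i1; split=> // j ji0; have := memt j.
rewrite !inE (negPf ji0) /= => /predU1P[->//|jt].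
by move: st; rewrite path_sortedE // => /andP[/allP /(_ _ jt)].
Qed.

Lemma lambda2_spectral m (A : 'M[R]_m) : A^T = A -> (1 < m)%N ->
  exists P : 'M[R[i]]_m, exists r : 'rV[R]_m, exists i0, exists i1,
  [/\ P \is unitarymx, map_mx toC A = P^t* *m map_mx toC (diag_mx r) *m P,
    i0 != i1, lambda 2 A = r 0 i1
    & r 0 i1 <= r 0 i0 /\ forall j, j != i0 -> r 0 j <= r 0 i1].
Proof.
move=> symA m1; have [P [r [PU AE chiA]]] := symmetric_spectral symA.
have [i0 [i1 [i01 e r01 rj]]] := sorted_second (fun i => r 0 i) m1.
exists P, r, i0, i1; split=> //; rewrite -[RHS]e /lambda.
rewrite (@eigenvaluesE _ _ _ (codom (fun i => r 0 i))) // chiA.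
by rewrite /codom /image_mem big_map big_enum.
Qed.

(** Both sides are real parts of hermitian forms, and P cancels against its adjoint on either side
    of D. For A = D = 1 this is the invariance of the norm. *)
Lemma hermitian_form_unitary m (A D : 'M[R]_m) (P : 'M[R[i]]_m) y :
    P \is unitarymx -> map_mx toC A = P^t* *m map_mx toC D *m P ->
  quad A (mxRe (y *m P)) + quad A (mxIm (y *m P))
  = quad D (mxRe y) + quad D (mxIm y).
Proof.
move=> PU AE; rewrite -!Re_hermitian_form AE trmx_mul map_mxM !mulmxA.
by rewrite !(mulmxtVK _ PU).
Qed.

Lemma norm_unitary m (P : 'M[R[i]]_m) y : P \is unitarymx ->
  quad 1%:M (mxRe (y *m P)) + quad 1%:M (mxIm (y *m P))
  = quad 1%:M (mxRe y) + quad 1%:M (mxIm y).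
Proof.
move=> PU; apply: hermitian_form_unitary => //.
by rewrite map_mx1 mulmx1 -invmx_unitary // mulVmx // unitarymx_unit.
Qed.

Lemma norm_complex_gt0 m (y : 'rV[R[i]]_m) : y != 0 ->
  0 < quad 1%:M (mxRe y) + quad 1%:M (mxIm y).
Proof.
move=> y0; rewrite !quad1 -big_split /= lt_def.
have pos i : 0 <= mxRe y 0 i ^+ 2 + mxIm y 0 i ^+ 2 by rewrite addr_ge0 ?sqr_ge0.
rewrite sumr_ge0 // andbT; apply: contra y0; rewrite psumr_eq0 // => /allP h.
apply/eqP/rowP => i; move: (h i (mem_index_enum i)).
rewrite !mxE /= paddr_eq0 ?sqr_ge0 // !sqrf_eq0.
by case: (y 0 i) => a b /= /andP[/eqP-> /eqP->].
Qed.

(* The span of two top eigenvectors meets the kernel of w.  The eigenvectors are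
   complex, but for x = u + i v the hermitian form of a real matrix at x has real
   part quad A u + quad A v, so that a bound on real vectors suffices. *)
Lemma lambda2_le m (A : 'M[R]_m) (w : 'rV[R]_m) (c : R) :
    A^T = A -> (1 < m)%N ->
    (forall u, u *m w^T = 0 -> quad A u <= c * quad 1%:M u) ->
  lambda 2 A <= c.
Proof.
move=> symA m1 hw.
have [P [r [i0 [i1 [PU AE i01 -> [r01 _]]]]]] := lambda2_spectral symA m1.
(* Entry i of [g] pairs [w] with row i of [P], an eigenvector of [A]. So if [y] is supported on
   [i0], [i1] and killed by [g], then [y *m P] lies both in the span of the two top eigenvectors and
   in the kernel of [w]. *)
pose g := P *m (map_mx toC w)^T.
have [y [y0 yg ysupp]] : exists y : 'rV[R[i]]_m, [/\ y != 0, y *m g = 0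
    & forall j, j != i0 -> j != i1 -> y 0 j = 0].
  clearbody g; have dg i : delta_mx 0 i *m g = (g i 0)%:M :> 'M_1.
    by rewrite -rowE; apply/matrixP => a b; rewrite !ord1 !mxE eqxx.
  have [g0|g0] := eqVneq (g i1 0) 0.
    exists (delta_mx 0 i1); split=> [||j _ j1].
    - by apply/eqP => /rowP/(_ i1)/eqP; rewrite !mxE !eqxx oner_eq0.
    - by rewrite dg g0; apply/matrixP => a b; rewrite !mxE mul0rn.
    - by rewrite mxE (negPf j1) andbF.
  exists (g i1 0 *: delta_mx 0 i0 - g i0 0 *: delta_mx 0 i1).
  split=> [||j j0 j1].
  - apply/eqP => /rowP/(_ i0)/eqP.
    by rewrite !mxE !eqxx (negPf i01) andbF mulr0 subr0 mulr1 (negPf g0).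
  - rewrite mulmxBl -!scalemxAl !dg; apply/matrixP => a b.
    by rewrite !ord1 !mxE eqxx !mulr1n mulrC subrr.
  - by rewrite !mxE (negPf j0) (negPf j1) !mulr0 subrr.
have npos := norm_complex_gt0 y0.
rewrite -(ler_pM2r npos) -{2}(norm_unitary y PU).
pose x := y *m P.
have xw : x *m map_mx toC w^T = 0 by rewrite /x -map_trmx -mulmxA.
have xr : quad A (mxRe x) <= c * quad 1%:M (mxRe x).
  apply: hw; rewrite -mxRe_mulmx_real xw.
  by apply/matrixP => a b; rewrite !mxE.
have xi : quad A (mxIm x) <= c * quad 1%:M (mxIm x).
  apply: hw; rewrite -mxIm_mulmx_real xw.
  by apply/matrixP => a b; rewrite !mxE.
rewrite [X in _ <= X]mulrDr; apply: le_trans (lerD xr xi).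
rewrite (hermitian_form_unitary _ PU AE) !quad_diag !quad1 mulrDr.
rewrite !mulr_sumr; apply: lerD; apply: ler_sum => j _; rewrite !mxE.
- have [->|j0] := eqVneq j i0; first by rewrite ler_wpM2r ?sqr_ge0.
  by have [->//|j1] := eqVneq j i1; rewrite ysupp //= expr0n !mulr0.
- have [->|j0] := eqVneq j i0; first by rewrite ler_wpM2r ?sqr_ge0.
  by have [->//|j1] := eqVneq j i1; rewrite ysupp //= expr0n !mulr0.
Qed.

(** Dually, the complexified row space of [U] is a plane, so it contains a nonzero vector orthogonal
    to the top eigenvector; there the form is at most the second eigenvalue times the squared
    norm. *)
Lemma lambda2_ge m (A : 'M[R]_m) (U : 'M[R]_(2, m)) (c : R) :
    A^T = A -> row_free U ->
    (forall a : 'rV_2, c * quad 1%:M (a *m U) <= quad A (a *m U)) ->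
  c <= lambda 2 A.
Proof.
move=> symA Ufree hU.
have m1 : (1 < m)%N by rewrite -(eqP Ufree) rank_leq_col.
have [P [r [i0 [i1 [PU AE i01 -> [r01 rj]]]]]] := lambda2_spectral symA m1.
pose UC := map_mx toC U; pose g := UC *m P^t*.
pose i2 : 'I_2 := lift ord0 ord0.
(* One linear condition on two coefficients has a nonzero solution; it removes the component along
   the eigenvector [i0]. *)
have [a a0 ag] : exists2 a : 'rV[R[i]]_2, a != 0 & (a *m g) 0 i0 = 0.
  clearbody g.
  have [g0|g0] := eqVneq (g i2 i0) 0.
    exists (delta_mx 0 i2); last by rewrite -rowE mxE.
    by apply/eqP => /rowP/(_ i2)/eqP; rewrite !mxE !eqxx oner_eq0.
  exists (g i2 i0 *: delta_mx 0 0 - g 0 i0 *: delta_mx 0 i2).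
    apply/eqP => /rowP/(_ 0)/eqP.
    by rewrite !mxE !eqxx /= mulr0 subr0 mulr1 (negPf g0).
  by rewrite mulmxBl -!scalemxAl -!rowE !mxE mulrC subrr.
pose y := a *m g.
have yP : y *m P = a *m UC by rewrite /y /g mulmxA mulmxKtV.
have yi0 : y 0 i0 = 0 by []; clearbody y.
have y0 : y != 0.
  apply: contra a0 => /eqP y0; rewrite y0 mul0mx in yP.
  by rewrite -(mulmx_free_eq0 _ (_ : row_free UC)) ?row_free_map // -yP.
have npos := norm_complex_gt0 y0.
rewrite -(ler_pM2r npos) -{1}(norm_unitary y PU).
rewrite yP mxRe_mulmx_real mxIm_mulmx_real mulrDr.
apply: le_trans (lerD (hU _) (hU _)) _.
rewrite -mxRe_mulmx_real -mxIm_mulmx_real -/UC -yP.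
rewrite (hermitian_form_unitary _ PU AE) !quad_diag !quad1 mulrDr.
rewrite !mulr_sumr; apply: lerD; apply: ler_sum => j _; rewrite !mxE.
- have [->|j0] := eqVneq j i0; first by rewrite yi0 /= expr0n !mulr0.
  by rewrite ler_wpM2r ?sqr_ge0 ?rj.
- have [->|j0] := eqVneq j i0; first by rewrite yi0 /= expr0n !mulr0.
  by rewrite ler_wpM2r ?sqr_ge0 ?rj.
Qed.
End Variational.

(** * The quadratic form of a graph *)

Section GraphForm.
Variables (R : realType) (H : sgraph) (alpha : R).

(** The quadratic form of [Aalpha_mx], on functions of the vertices so that their enumeration
    disappears. *)
Definition graph_form (x : H -> R) : R :=
  alpha * (\sum_v (degree v)%:R * x v ^+ 2)
  + (1 - alpha) * (\sum_u \sum_v (adj u v)%:R * (x u * x v)).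

Lemma sum_enum_val (F : H -> R) : \sum_(i < #|H|) F (enum_val i) = \sum_v F v.
Proof. by rewrite -big_enum_val; apply: eq_bigl. Qed.

Lemma Aalpha_sym : (Aalpha_mx H alpha)^T = Aalpha_mx H alpha.
Proof.
rewrite /Aalpha_mx linearD !linearZ /= tr_diag_mx; congr (_ + _ *: _).
by apply/matrixP => i j; rewrite !mxE adj_sym.
Qed.

Lemma quad_Aalpha (x : H -> R) :
  quad (Aalpha_mx H alpha) (\row_i x (enum_val i)) = graph_form x.
Proof.
rewrite /quad /Aalpha_mx mulmxDr mulmxDl -!scalemxAr -!scalemxAl mxE.
rewrite [X in X + _]mxE [X in _ + X]mxE -!/(quad _ _) quad_diag quadE.
congr (_ * _ + _ * _).
  rewrite -[RHS]sum_enum_val; apply: eq_bigr => i _; by rewrite !mxE.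
rewrite -[RHS]sum_enum_val; apply: eq_bigr => i _.
rewrite -[RHS]sum_enum_val; apply: eq_bigr => j _.
by rewrite !mxE mulrAC mulrC.
Qed.

Lemma quad1_graph (x : H -> R) :
  quad 1%:M (\row_(i < #|H|) x (enum_val i)) = \sum_v x v ^+ 2.
Proof. by rewrite quad1 -sum_enum_val; apply: eq_bigr => i _; rewrite mxE. Qed.

(** The hyperplane is the orthogonal complement of the all-ones vector. *)
Lemma lambda2_Aalpha_le (c : R) : (1 < #|H|)%N ->
    (forall x : H -> R, \sum_v x v = 0 ->
       graph_form x <= c * \sum_v x v ^+ 2) ->
  lambda 2 (Aalpha_mx H alpha) <= c.
Proof.
move=> H1 hx; apply: (@lambda2_le _ _ _ (const_mx 1)) => // [|u uw].
  exact: Aalpha_sym.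
pose x v := u 0 (enum_rank v).
have -> : u = \row_i x (enum_val i).
  by apply/rowP => i; rewrite mxE /x enum_valK.
rewrite quad_Aalpha quad1_graph; apply: hx.
move/matrixP/(_ 0 0): uw; rewrite !mxE => uw0; rewrite -[LHS]sum_enum_val -[RHS]uw0.
by apply: eq_bigr => i _; rewrite !mxE mulr1 /x enum_valK.
Qed.

Lemma lambda2_Aalpha_ge (c : R) (x1 x2 : H -> R) :
    (forall a b, (forall v, a * x1 v + b * x2 v = 0) -> a = 0 /\ b = 0) ->
    (forall a b, c * (\sum_v (a * x1 v + b * x2 v) ^+ 2)
                 <= graph_form (fun v => a * x1 v + b * x2 v)) ->
  c <= lambda 2 (Aalpha_mx H alpha).
Proof.
move=> indep hx; pose i2 : 'I_2 := lift ord0 ord0.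
pose U : 'M[R]_(2, #|H|) :=
  \matrix_(i, j) (if i == 0 then x1 else x2) (enum_val j).
have aU (a : 'rV_2) :
    a *m U = \row_i (a 0 0 * x1 (enum_val i) + a 0 i2 * x2 (enum_val i)).
  by apply/rowP => j; rewrite !mxE big_ord_recl big_ord1 !mxE.
apply: (@lambda2_ge _ _ _ U); first exact: Aalpha_sym.
  apply: inj_row_free => a; rewrite aU => /rowP a0.
  have [v|a00 a02] := indep (a 0 0) (a 0 i2).
    by have := a0 (enum_rank v); rewrite !mxE enum_rankK.
  apply/rowP => j; rewrite mxE.
  by case: (unliftP 0 j) => [k ->|-> //]; rewrite ord1.
move=> a; rewrite aU (quad1_graph (fun v => a 0 0 * x1 v + a 0 i2 * x2 v)).
by rewrite (quad_Aalpha (fun v => a 0 0 * x1 v + a 0 i2 * x2 v)).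
Qed.
End GraphForm.

(** * Incidence counting and the norm of the incidence map *)

Section LineGraphCounting.
Variable G : sgraph.
Implicit Types (e f : edge G) (u v : G).

Lemma edge_ends e : exists a b, adj a b /\ val e = [set a; b].
Proof.
have := valP e; rewrite inE => /existsP[a /existsP[b /andP[ab /eqP->]]].
by exists a, b.
Qed.

Lemma adj_neq u v : adj u v -> u != v.
Proof. by move=> uv; apply: contraTneq uv => ->; rewrite adj_irr. Qed.

Lemma mem_edges u v : adj u v -> [set u; v] \in edges G.
Proof.
by move=> uv; rewrite inE; apply/existsP; exists u; apply/existsP; exists v;
   rewrite uv eqxx.
Qed.

Definition mk_edge u v (uv : adj u v) : edge G :=
  exist (fun E => E \in edges G) [set u; v] (mem_edges uv).

Lemma card_edge e : #|val e| = 2%N.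
Proof. by have [a [b [ab ->]]] := edge_ends e; rewrite cards2 adj_neq. Qed.

(** Distinct edges share at most one vertex. This is the entrywise form of B^T B = 2 I + A(l(G)),
    with B the incidence matrix. *)
Lemma card_edgeI e f :
  #|val e :&: val f| = ((e == f) * 2 + line_adj e f)%N.
Proof.
rewrite /line_adj; have [->|ef] := eqVneq e f; first by rewrite setIid card_edge.
have [->|I0] := eqVneq (val e :&: val f) set0; first by rewrite cards0.
apply/eqP; rewrite eqn_leq card_gt0 I0 andbT -ltnS -[X in (_ < X)%N](card_edge e).
rewrite proper_card // properEneq subsetIl andbT.
apply: contra ef => /eqP/setIidPl sef; apply/eqP/val_inj/eqP.
by rewrite eqEcard sef !card_edge.
Qed.

Lemma card_incident v : #|[set e : edge G | v \in val e]| = degree v.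
Proof.
rewrite /degree -(card_imset _ val_inj).
have inj : {in [set u | adj v u] &, injective (fun u => [set v; u])}.
  move=> u w; rewrite !inE => vu _ /setP/(_ u); rewrite !inE eqxx orbT eq_sym.
  by rewrite (negPf (adj_neq vu)) => /esym/eqP.
rewrite -(card_in_imset inj); congr #|pred_of_set _|; apply/setP => E.
apply/imsetP/imsetP => [[e]|[u]]; rewrite inE.
  have [a [b [ab ->]]] := edge_ends e; rewrite !inE => /orP[]/eqP -> ->.
    by exists b; rewrite ?inE.
  by exists a; rewrite ?inE 1?adj_sym // setUC.
move=> vu ->; exists (mk_edge vu) => //.
by rewrite inE /= !inE eqxx.
Qed.

(** Double counting of the pairs (f, v) with v in both e and f; the 2 is the contribution of f =
    e. *)
Lemma line_degree e :
  (@degree (line_graph G) e + 2 = \sum_(v in val e) degree v)%N.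
Proof.
transitivity (\sum_(f : edge G) #|val e :&: val f|)%N.
  under eq_bigr do rewrite card_edgeI.
  rewrite big_split /= addnC; congr (_ + _)%N.
    by rewrite (bigD1 e) //= eqxx big1 // => f /negPf fe; rewrite eq_sym fe.
  by rewrite /degree -sum1_card -[RHS]big_mkcond /=; apply: eq_bigl => f; rewrite inE.
under eq_bigr do rewrite -sum1_card big_mkcond /=.
rewrite exchange_big [RHS]big_mkcond /=; apply: eq_bigr => v _.
rewrite -card_incident -sum1_card.
case: ifP => ve; last by rewrite big1 // => f _; rewrite inE ve.
by rewrite -big_mkcond; apply: eq_bigl => f; rewrite !inE ve.
Qed.

Lemma degree_le v : (degree v <= #|G|.-1)%N.
Proof.
rewrite -(cardsC1 v); apply: subset_leq_card; apply/subsetP => u.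
by rewrite !inE eq_sym => /adj_neq.
Qed.

Lemma line_degree_le e : (@degree (line_graph G) e + 2 <= #|G|.-1 * 2)%N.
Proof.
have -> : (#|G|.-1 * 2 = \sum_(v in val e) #|G|.-1)%N.
  by rewrite sum_nat_const card_edge mulnC.
rewrite line_degree.
by apply: leq_sum => v _; exact: degree_le.
Qed.

Variable R : realType.

(** Each edge comes from exactly two ordered pairs of adjacent vertices. *)
Lemma sum_edge_pairs (F : {set G} -> R) :
  \sum_u \sum_(v | adj u v) F [set u; v] = 2 * \sum_(e : edge G) F (val e).
Proof.
have pairs e : #|[set p : G * G | adj p.1 p.2 && (val e == [set p.1; p.2])]| = 2%N.
  have [a [b [ab eE]]] := edge_ends e.
  have -> : 2%N = #|[set (a, b); (b, a)]|.
    by rewrite cards2 xpair_eqE negb_and (adj_neq ab).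
  apply: eq_card => -[u v]; rewrite !inE /= eE !xpair_eqE.
  apply/andP/orP => [[uv /eqP E]|[]/andP[/eqP-> /eqP->]]; last 2 first.
  - by rewrite ab.
  - by rewrite adj_sym ab setUC.
  have /setP/(_ u) := E; have /setP/(_ v) := E.
  rewrite !inE !eqxx orbT /= => /orP[]/eqP vE /orP[]/eqP uE.
  - by rewrite uE vE adj_irr in uv.
  - by right; rewrite uE vE !eqxx.
  - by left; rewrite uE vE !eqxx.
  - by rewrite uE vE adj_irr in uv.
rewrite pair_big_dep /=.
have FE (p : G * G) : adj p.1 p.2 ->
    F [set p.1; p.2] = \sum_(e : edge G | val e == [set p.1; p.2]) F (val e).
  move=> uv; rewrite (bigD1 (mk_edge uv)) //= big1 ?addr0 //.
  by move=> e /andP[/eqP eE /eqP[]]; apply/val_inj.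
rewrite (eq_bigr _ FE) (exchange_big_dep xpredT) //= mulr_sumr.
apply: eq_bigr => e _; rewrite sumr_const mulr_natl -(pairs e).
by rewrite cardsE.
Qed.

(** In the expanded squares the coefficient of x_e x_f is the size of the intersection of e and f,
    which [card_edgeI] evaluates. *)
Lemma line_form (x : edge G -> R) :
  \sum_e \sum_f (line_adj e f)%:R * (x e * x f)
  = \sum_v (\sum_(e : edge G | v \in val e) x e) ^+ 2 - 2 * \sum_e x e ^+ 2.
Proof.
apply/esym/eqP; rewrite subr_eq; apply/eqP.
transitivity (\sum_(e : edge G) \sum_(f : edge G) #|val e :&: val f|%:R * (x e * x f)).
  under eq_bigr => v _ do rewrite expr2 big_mkcond /= big_distrlr /=.
  rewrite exchange_big; apply: eq_bigr => e _.
  rewrite exchange_big; apply: eq_bigr => f _ /=.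
  rewrite -sum1_card natr_sum mulr_suml [RHS]big_mkcond /=.
  apply: eq_bigr => v _; rewrite inE.
  by do 2!case: ifP; rewrite ?mul0r ?mulr0 ?mul1r.
rewrite mulr_sumr -big_split /=; apply: eq_bigr => e _.
under eq_bigr do rewrite card_edgeI natrD mulrDl.
rewrite big_split addrC /=; congr (_ + _).
rewrite (bigD1 e) //= eqxx big1 ?addr0 ?mul1n // => f /negPf fe.
by rewrite eq_sym fe mul0r.
Qed.

(** Over all pairs the cross terms cancel and the sum is 2n|y|^2; the diagonal takes away 4|y|^2. *)
Lemma sum_offdiag_sqr (y : G -> R) : \sum_v y v = 0 ->
  \sum_u \sum_(v | v != u) (y u + y v) ^+ 2
  = 2 * ((#|G|%:R - 2) * \sum_v y v ^+ 2).
Proof.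
move=> y0.
have inner u : \sum_(v | v != u) (y u + y v) ^+ 2
    = #|G|%:R * y u ^+ 2 + \sum_v y v ^+ 2 - 4 * y u ^+ 2.
  have split_sum : \sum_v (y u + y v) ^+ 2
      = (y u + y u) ^+ 2 + \sum_(v | v != u) (y u + y v) ^+ 2.
    by rewrite (bigD1 u).
  have expand : \sum_v (y u + y v) ^+ 2
      = #|G|%:R * y u ^+ 2 + \sum_v y v ^+ 2.
    under eq_bigr do rewrite sqrrD.
    rewrite !big_split /= sumr_const mulr_natl.
    by rewrite -mulr_sumr y0 mulr0 !addr0.
  by rewrite expand in split_sum; lra.
under eq_bigr do rewrite inner.
rewrite !big_split /= sumrN -!mulr_sumr sumr_const.
by rewrite -mulr_natl; ring.
Qed.

Lemma edge_sum_pair (y : G -> R) u v : adj u v ->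
  \sum_(w in [set u; v]) y w = y u + y v.
Proof.
by move=> uv; rewrite big_setU1 ?inE ?adj_neq //= big_set1.
Qed.

Lemma edge_sum_sqr_le (y : G -> R) : \sum_v y v = 0 ->
  \sum_(e : edge G) (\sum_(v in val e) y v) ^+ 2 <= (#|G|%:R - 2) * \sum_v y v ^+ 2.
Proof.
move=> y0; rewrite -(@ler_pM2l _ 2) // -sum_offdiag_sqr //.
rewrite -(sum_edge_pairs (fun E => (\sum_(v in E) y v) ^+ 2)).
apply: ler_sum => u _; rewrite big_mkcond [leRHS]big_mkcond /=.
apply: ler_sum => v _; case: ifP => uv; last by case: ifP; rewrite ?sqr_ge0.
by rewrite edge_sum_pair // eq_sym (adj_neq uv).
Qed.

Lemma edge_sum_sqr_complete (y : G -> R) :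
    (forall u v, adj u v = (u != v)) -> \sum_v y v = 0 ->
  \sum_(e : edge G) (\sum_(v in val e) y v) ^+ 2 = (#|G|%:R - 2) * \sum_v y v ^+ 2.
Proof.
move=> K y0; apply: (@mulfI _ 2); first by rewrite pnatr_eq0.
rewrite -sum_offdiag_sqr //.
rewrite -(sum_edge_pairs (fun E => (\sum_(v in E) y v) ^+ 2)).
apply: eq_bigr => u _; apply: eq_big => v; first by rewrite K eq_sym.
by move=> uv; rewrite edge_sum_pair.
Qed.

Lemma incidence_adjoint (x : edge G -> R) (y : G -> R) :
  \sum_v y v * (\sum_(e : edge G | v \in val e) x e)
  = \sum_e x e * (\sum_(v in val e) y v).
Proof.
under eq_bigr do rewrite big_mkcond mulr_sumr.
rewrite exchange_big; apply: eq_bigr => e _ /=.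
rewrite [in RHS]big_mkcond mulr_sumr; apply: eq_bigr => v _.
by case: ifP; rewrite ?mulr0 // mulrC.
Qed.

Lemma incidence_norm_le (x : edge G -> R) :
    (2 < #|G|)%N -> \sum_e x e = 0 ->
  \sum_v (\sum_(e : edge G | v \in val e) x e) ^+ 2
  <= (#|G|%:R - 2) * \sum_e x e ^+ 2.
Proof.
(* Expand 0 <= |k x - s|^2 where k = n - 2 and s is the image of y under the
   adjoint of the incidence map; this stands in for Cauchy-Schwarz. *)
move=> n3 x0; pose y v := \sum_(e : edge G | v \in val e) x e.
pose k : R := #|G|%:R - 2; rewrite -/k.
have k0 : 0 < k by rewrite subr_gt0 ltr_nat.
(* Adjointness against the constant function 1: each edge has two ends, so the sum of [y] is twice
   that of [x]. *)
have y0 : \sum_v y v = 0.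
  transitivity (\sum_v 1 * y v); first by under [RHS]eq_bigr do rewrite mul1r.
  rewrite incidence_adjoint.
  under eq_bigr do rewrite sumr_const card_edge.
  by rewrite -mulr_suml x0 mul0r.
have yE : \sum_v y v ^+ 2 = \sum_e x e * (\sum_(v in val e) y v).
  by rewrite -incidence_adjoint; apply: eq_bigr => v _; rewrite expr2.
have sle := edge_sum_sqr_le y0; rewrite -/k in sle.
have : 0 <= \sum_e (k * x e - \sum_(v in val e) y v) ^+ 2.
  by apply: sumr_ge0 => e _; exact: sqr_ge0.
have -> : \sum_e (k * x e - \sum_(v in val e) y v) ^+ 2
   = k ^+ 2 * (\sum_e x e ^+ 2) - 2 * k * (\sum_v y v ^+ 2)
     + \sum_(e : edge G) (\sum_(v in val e) y v) ^+ 2.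
  rewrite yE !mulr_sumr -sumrN -!big_split /=; apply: eq_bigr => e _; ring.
(* From 0 <= k^2 X - 2 k Y + S and S <= k Y follows k Y <= k^2 X, which is the goal multiplied by
   k. *)
move=> h; rewrite -(ler_pM2l k0) -/(y _); move: sle h.
set X := \sum_e x e ^+ 2; set Y := \sum_v y v ^+ 2; set S := \sum_e _.
rewrite -[X in _ <= _ * X]/Y; nra.
Qed.
End LineGraphCounting.

(** * Bounds on the second eigenvalue for line graphs *)

Section LineGraphBounds.
Variables (R : realType) (G : sgraph) (alpha : R).
Hypothesis alpha01 : 0 <= alpha <= 1.

(** The diagonal part is bounded through [D], the adjacency part by (n - 2) - 2. Keeping [D] free
    serves both the general bound, with 2n - 4, and P_3, with 1. *)
Lemma lambda2_line_le (D : nat) :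
    (2 < #|G|)%N -> (1 < #|edge G|)%N ->
    (forall e : line_graph G, (degree e <= D)%N) ->
  lambda 2 (Aalpha_mx (line_graph G) alpha)
  <= alpha * D%:R + (1 - alpha) * (#|G|%:R - 4).
Proof.
case/andP: alpha01 => a0 a1 n3 e2 degD.
apply: lambda2_Aalpha_le => // x x0; rewrite /graph_form (line_form x).
rewrite [leRHS]mulrDl -!mulrA; apply: lerD; apply: ler_wpM2l; rewrite ?subr_ge0 //.
  rewrite mulr_sumr; apply: ler_sum => e _.
  by rewrite ler_wpM2r ?sqr_ge0 // ler_nat.
by have := incidence_norm_le n3 x0; lra.
Qed.

(** On a vector with entries a at [e] and b at [f], the degrees are at least 1 and the adjacency
    form is 2ab; subtracting (2 alpha - 1)(a^2 + b^2) leaves at least (1 - alpha)(a + b)^2. *)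
Lemma lambda2_line_ge_adjacent (e f : line_graph G) : adj e f ->
  2 * alpha - 1 <= lambda 2 (Aalpha_mx (line_graph G) alpha).
Proof.
case/andP: alpha01 => a0 a1 ef.
have nef : e != f by apply: contraTneq ef => ->; rewrite adj_irr.
have nfe : f != e by rewrite eq_sym.
pose d (h g : line_graph G) : R := (g == h)%:R.
have sumd a b (F : line_graph G -> R) :
    \sum_g (a * d e g + b * d f g) * F g = a * F e + b * F f.
  rewrite (bigD1 e) //= (bigD1 f) //= big1 => [|g /andP[/negPf ge /negPf gf]].
    by rewrite /d !eqxx (negPf nef) (negPf nfe) /=; ring.
  by rewrite /d ge gf /=; ring.
apply: (@lambda2_Aalpha_ge _ _ _ _ (d e) (d f)) => [a b ab|a b].
  by have := ab f; have := ab e; rewrite /d !eqxx (negPf nef) (negPf nfe) /= => *; lra.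
pose x g := a * d e g + b * d f g.
have normx : \sum_g x g ^+ 2 = a ^+ 2 + b ^+ 2.
  under eq_bigr do rewrite expr2; rewrite sumd.
  by rewrite /x /d !eqxx (negPf nef) (negPf nfe) /=; ring.
have crossx : \sum_g \sum_h (adj g h)%:R * (x g * x h) = 2 * (a * b).
  have inner g : \sum_h (adj g h)%:R * (x g * x h)
      = x g * (a * (adj g e)%:R + b * (adj g f)%:R).
    rewrite -(sumd a b (fun h => (adj g h)%:R)) mulr_sumr; apply: eq_bigr => h _; rewrite /x; ring.
  under eq_bigr do rewrite inner.
  by rewrite sumd !adj_irr ef adj_sym ef /=; ring.
have deg_pos (g h : line_graph G) : adj g h -> (1 <= degree g)%N.
  by move=> gh; apply/card_gt0P; exists h; rewrite inE.
have degx : a ^+ 2 + b ^+ 2 <= \sum_g (degree g)%:R * x g ^+ 2.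
  rewrite -normx; apply: ler_sum => g _.
  have [->|ge] := eqVneq g e.
    by rewrite ler_peMl ?sqr_ge0 // ler1n (deg_pos _ f).
  have [->|gf] := eqVneq g f.
    by rewrite ler_peMl ?sqr_ge0 // ler1n (deg_pos _ e) // adj_sym.
  by rewrite /x /d (negPf ge) (negPf gf) !mulr0 addr0 expr0n mulr0.
rewrite /graph_form normx crossx.
have : 0 <= alpha * (\sum_g (degree g)%:R * x g ^+ 2 - (a ^+ 2 + b ^+ 2)).
  by rewrite mulr_ge0 // subr_ge0.
have : 0 <= (1 - alpha) * (a + b) ^+ 2 by rewrite mulr_ge0 ?sqr_ge0 ?subr_ge0.
by nra.
Qed.

Lemma lambda2_line_complete_ge : (2 < #|G|)%N ->
    (forall u v : G, adj u v = (u != v)) ->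
  #|G|%:R * (alpha + 1) - 4 <= lambda 2 (Aalpha_mx (line_graph G) alpha).
Proof.
case/andP: alpha01 => a0 a1 n3 K.
pose k : R := #|G|%:R - 2.
have k0 : 0 < k by rewrite subr_gt0 ltr_nat.
have deg_line (e : line_graph G) : (degree e)%:R = 2 * k.
  have degK (v : G) : degree v = #|G|.-1.
    by rewrite -(cardsC1 v); apply: eq_card => u; rewrite !inE K eq_sym.
  have := line_degree e; under eq_bigr do rewrite degK.
  rewrite sum_nat_const card_edge => degE.
  have {degE} : (degree e + 4 = 2 * #|G|)%N by lia.
  by move/(congr1 (fun m => m%:R : R)); rewrite natrD natrM /k; lra.
have [p [q [s [pq ps qs]]]] : exists p q s : G, [/\ p != q, p != s & q != s].
  have /card_gt2P[p [q [s [_ [pq qs sp]]]]] := n3.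
  by exists p, q, s; rewrite pq qs eq_sym sp.
(* Two independent vectors of sum 0 on three distinct vertices; their images on the edges span the
   test plane. *)
pose y1 v : R := (v == p)%:R - (v == s)%:R.
pose y2 v : R := (v == q)%:R - (v == s)%:R.
pose x1 (e : line_graph G) := \sum_(v in val e) y1 v.
pose x2 (e : line_graph G) := \sum_(v in val e) y2 v.
pose y a b v := a * y1 v + b * y2 v.
have sum1 (w : G) : \sum_v (v == w)%:R = 1 :> R.
  by rewrite (bigD1 w) //= eqxx big1 ?addr0 // => v /negPf->.
have y0 a b : \sum_v y a b v = 0.
  by rewrite big_split -!mulr_sumr /= !sumrB !sum1 !subrr !mulr0 addr0.
have xE a b e : a * x1 e + b * x2 e = \sum_(v in val e) y a b v.
  by rewrite big_split -!mulr_sumr.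
have normx a b := edge_sum_sqr_complete K (y0 a b).
apply: (@lambda2_Aalpha_ge _ _ _ _ x1 x2) => [a b ab|a b].
  (* The map from y to x multiplies the squared norm by k > 0 on sum-zero vectors, so x = 0 forces y
     = 0; the values at [p] and [q] then give a = b = 0. *)
  have /eqP : k * \sum_v y a b v ^+ 2 = 0.
    by rewrite /k -normx big1 // => e _; rewrite -xE ab expr0n.
  rewrite mulf_eq0 gt_eqF //= psumr_eq0 => [/allP yz|v _]; last exact: sqr_ge0.
  have yz0 v : y a b v = 0.
    by apply/eqP; rewrite -sqrf_eq0; exact: yz (mem_index_enum v).
  have := yz0 q; have := yz0 p; rewrite /y /y1 /y2 !eqxx [q == p]eq_sym (negPf pq).
  by rewrite (negPf ps) (negPf qs) /= => *; lra.
pose x (e : line_graph G) := \sum_(v in val e) y a b v.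
rewrite /graph_form.
have -> : \sum_e (a * x1 e + b * x2 e) ^+ 2 = \sum_e x e ^+ 2.
  by apply: eq_bigr => e _; rewrite xE.
have -> : \sum_e (degree e)%:R * (a * x1 e + b * x2 e) ^+ 2
    = 2 * k * \sum_e x e ^+ 2.
  by rewrite mulr_sumr; apply: eq_bigr => e _; rewrite xE deg_line.
have -> : \sum_e \sum_f (adj e f)%:R * ((a * x1 e + b * x2 e) * (a * x1 f + b * x2 f))
    = \sum_(e : edge G) \sum_(f : edge G) (line_adj e f)%:R * (x e * x f).
  by apply: eq_bigr => e _; apply: eq_bigr => f _; rewrite !xE.
rewrite line_form.
have Xk : \sum_e x e ^+ 2 = k * \sum_v y a b v ^+ 2 by exact: normx.
pose z v := \sum_(e : edge G | v \in val e) x e.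
have zy : \sum_v y a b v * z v = \sum_e x e ^+ 2.
  by rewrite incidence_adjoint; apply: eq_bigr => e _; rewrite expr2.
(* Since the pairing of y and z is |x|^2 = k|y|^2, this square expands to |z|^2 - k|x|^2, the lower
   bound on |z|^2 that the adjacency form needs. *)
have : 0 <= \sum_v (z v - k * y a b v) ^+ 2.
  by apply: sumr_ge0 => v _; exact: sqr_ge0.
have -> : \sum_v (z v - k * y a b v) ^+ 2
    = \sum_v z v ^+ 2 - 2 * k * (\sum_v y a b v * z v)
      + k ^+ 2 * (\sum_v y a b v ^+ 2).
  by rewrite !mulr_sumr -sumrN -!big_split /=; apply: eq_bigr => v _; ring.
rewrite zy expr2 -(mulrA k k) -Xk => zge.
have {}zge : 0 <= (1 - alpha) * (\sum_v z v ^+ 2 - k * \sum_e x e ^+ 2).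
  by rewrite mulr_ge0 ?subr_ge0 //; lra.
by move: zge; rewrite /z /k; nra.
Qed.
End LineGraphBounds.

(** * Adjacent edges in connected graphs, and the extremal graphs *)

Lemma connected_edge_out (G : sgraph) (S : {set G}) (x y : G) :
    graph_connected G -> x \in S -> y \notin S ->
  exists u v, [/\ u \in S, v \notin S & adj u v].
Proof.
move=> conn xS yS.
have [/existsP[u /existsP[v /and3P[]]]|none] :=
  boolP [exists u, exists v, [&& u \in S, v \notin S & adj u v]].
  by exists u, v.
(* A set that no edge leaves is closed under adjacency, hence a union of components. *)
have clS : closed (@adj G) S.
  apply: intro_closed => [|u v uv uS]; first exact: sym_connect_sym (@adj_sym G).
  apply: contraNT none => vS; apply/existsP; exists u; apply/existsP; exists v.
  by rewrite uS vS.
by rewrite (closed_connect clS (conn x y)) (negPf yS) in xS.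
Qed.

(** An edge leaves a single vertex x, towards v; a further edge leaves {x, v}. The end at which it
    leaves is the middle vertex. *)
Lemma connected_cherry (G : sgraph) : graph_connected G -> (2 < #|G|)%N ->
  exists a b c : G, [/\ adj a b, adj b c & a != c].
Proof.
move=> conn n3.
have outside (S : {set G}) : (#|S| <= 2)%N -> exists y, y \notin S.
  move=> S2; apply/existsP; rewrite -negb_forall; apply: contraTN n3 => /forallP h.
  rewrite -leqNgt (leq_trans _ S2) // subset_leq_card //.
  by apply/subsetP => v _; exact: h.
have [|x _] := outside set0; first by rewrite cards0.
have [|y yx] := outside [set x]; first by rewrite cards1.
have [u [v [/set1P -> _ xv]]] := connected_edge_out conn (set11 x) yx.
have [|w wS] := outside [set x; v]; first by rewrite cards2; case: (_ != _).
have [p [q [+ qS pq]]] := connected_edge_out conn (set21 x v) wS.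
move: qS; rewrite !inE negb_or => /andP[qx qv] /orP[]/eqP pE; rewrite pE in pq.
  by exists v, x, q; rewrite adj_sym eq_sym.
by exists x, v, q; rewrite eq_sym.
Qed.

Lemma complete_iso_adj (G : sgraph) n : G ~=g complete_graph n ->
  forall u v : G, adj u v = (u != v).
Proof.
move=> [f fbij fadj] u v; rewrite -fadj /= /complete_adj.
by rewrite (inj_eq (bij_inj fbij)).
Qed.

(** Adjacent vertices of P_3 have degrees adding up to at most 3, and [line_degree] subtracts 2. *)
Lemma path3_iso_line_degree (G : sgraph) : G ~=g path_graph 3 ->
  forall e : line_graph G, (degree e <= 1)%N.
Proof.
move=> [f fbij fadj] e; have [a [b [ab eE]]] := edge_ends e.
have degf u : degree u = @degree (path_graph 3) (f u).
  rewrite /degree -(card_imset _ (bij_inj fbij)); apply: eq_card => w.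
  have [g gK Kg] := fbij; rewrite -[w]Kg mem_imset ?inE; last exact: bij_inj.
  by rewrite fadj.
have deg3 i j : @adj (path_graph 3) i j ->
    (@degree (path_graph 3) i + @degree (path_graph 3) j <= 3)%N.
  have nb (i' : path_graph 3) : degree i' = (\sum_(j' < 3) path_adj i' j')%N.
    by rewrite /degree -sum1_card big_mkcond; apply: eq_bigr => j' _; rewrite inE.
  rewrite !nb !big_ord_recl !big_ord0 /= /path_adj.
  by case: i => [[|[|[|]]] ?] //; case: j => [[|[|[|]]] ?].
have := line_degree e; rewrite eE big_setU1 ?inE ?adj_neq //= big_set1 !degf.
have := deg3 (f a) (f b); rewrite fadj ab => /(_ isT); lia.
Qed.

Theorem theorem14 (R : realType) (G : sgraph) (n : nat) (alpha : R)
    (hn : #|G| = n) (hn3 : (3 <= n)%N) (hG : graph_connected G)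
    (halpha : 0 <= alpha <= 1) :
  [/\ 2 * alpha - 1 <= lambda 2 (Aalpha_mx (line_graph G) alpha)
        <= n%:R * (alpha + 1) - 4,
      G ~=g path_graph 3 ->
        lambda 2 (Aalpha_mx (line_graph G) alpha) = 2 * alpha - 1 &
      G ~=g complete_graph n ->
        lambda 2 (Aalpha_mx (line_graph G) alpha) = n%:R * (alpha + 1) - 4].
Proof.
move: hn3; rewrite -hn => n3.
have [a [b [c [ab bc ac]]]] := connected_cherry hG n3.
pose e : line_graph G := mk_edge ab; pose f : line_graph G := mk_edge bc.
have ef : e != f.
  apply/eqP => /(congr1 val)/setP/(_ a).
  by rewrite !inE eqxx (negPf ac) (negPf (adj_neq ab)).
have adj_ef : adj e f.
  apply/andP; split=> //; apply/set0Pn; exists b.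
  by rewrite !inE eqxx orbT.
(* With two edges, [lambda 2] is a genuine eigenvalue and not the default 0. *)
have e2 : (1 < #|edge G|)%N by apply/card_gt1P; exists e, f.
have lower := lambda2_line_ge_adjacent halpha adj_ef.
have upper : lambda 2 (Aalpha_mx (line_graph G) alpha)
    <= #|G|%:R * (alpha + 1) - 4.
  have deg_le (g : line_graph G) : (degree g <= 2 * (#|G| - 2))%N.
    by have := line_degree_le g; lia.
  apply: le_trans (lambda2_line_le halpha n3 e2 deg_le) _.
  by rewrite natrM natrB ?(ltnW n3) //; lra.
split=> [|P3|Kn]; first by rewrite lower upper.
- apply/le_anti; rewrite lower andbT.
  (* For degree bound 1 and n = 3 the estimate reads alpha + (1 - alpha)(3 - 4) = 2 alpha - 1. *)
  have := lambda2_line_le halpha n3 e2 (path3_iso_line_degree P3).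
  have [g gbij _] := P3; rewrite (bij_eq_card gbij) card_ord; lra.
- apply/le_anti; rewrite upper.
  exact: (lambda2_line_complete_ge halpha n3 (complete_iso_adj Kn)).
Qed.
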